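(* Let $M$ be a connected manifold, let $n$ be the minimum positive integer such that $H_n(M;\mathbb{Z})\neq0$, let $\Omega$ be a closed $n$-form on $M$ whose class $[\Omega]\in H^n(M;\mathbb{R})$ is non-zero and lies in the image of $H^n(M;\mathbb{Z})\to H^n(M;\mathbb{R})$, and let $G=\mathrm{Diff}_\Omega(M)$ be the group of $\Omega$-preserving diffeomorphisms of $M$. Then the group cochains $c_k=\langle\delta w_k,\Delta_k\rangle\in C^{n+1}_{\mathrm{grp}}(G;\mathbb{Z})$, $0\le k\le n$, are cocycles and are cohomologous to each other.
   Context: **Group cochains.** For a group $G$ and a $G$-module $A$, $C^p_{\mathrm{grp}}(G;A)$ is the group of all maps $c:G^p\to A$ (with $C^0_{\mathrm{grp}}(G;A)=A$). The coboundary $\delta:C^p_{\mathrm{grp}}(G;A)\to C^{p+1}_{\mathrm{grp}}(G;A)$ is, for $A$ a left $G$-module, $$\delta c(g_1,\dots,g_{p+1})=g_1c(g_2,\dots,g_{p+1})+\sum_{i=1}^p(-1)^ic(g_1,\dots,g_ig_{i+1},\dots,g_{p+1})+(-1)^{p+1}c(g_1,\dots,g_p),$$ and, for $A$ a right $G$-module, $$\delta c(g_1,\dots,g_{p+1})=c(g_2,\dots,g_{p+1})+\sum_{i=1}^p(-1)^ic(g_1,\dots,g_ig_{i+1},\dots,g_{p+1})+(-1)^{p+1}c(g_1,\dots,g_p)g_{p+1}.$$ $H^*_{\mathrm{grp}}(G;A)$ is the resulting cohomology; $\mathbb{Z}$ is the trivial $G$-module. **The cochains $c_k$.** Let $(C_*(M;\mathbb{Z}),\partial)$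 and $(C^*(M;\mathbb{Z}),d)$ be the singular chain and cochain complexes, regarded as left $G$-modules (by pushforward) and right $G$-modules (by pullback) respectively. The operators $\partial,d$ act on group cochains by acting on values. Choose: - a point $x\in M$ and $\Delta_0=x\in C_0(M;\mathbb{Z})=C^0_{\mathrm{grp}}(G;C_0(M;\mathbb{Z}))$, and $\Delta_k\in C^k_{\mathrm{grp}}(G;C_k(M;\mathbb{Z}))$ for $1\le k\le n$ with $\delta\Delta_k=\partial\Delta_{k+1}$ for $0\le k<n$; - a singular cocycle $w_n\in C^n(M;\mathbb{Z})=C^0_{\mathrm{grp}}(G;C^n(M;\mathbb{Z}))$ whose class $[w_n]\in H^n(M;\mathbb{Z})$ maps to $[\Omega]\in H^n(M;\mathbb{R})$, and $w_k\in C^{n-k}_{\mathrm{grp}}(G;C^k(M;\mathbb{Z}))$ for $0\le k<n$ with $\delta w_k=-(-1)^{n-k+1}dw_{k-1}$ for $0<k\le n$. Such choices exist. The evaluation pairing $C^r(M;\mathbb{Z})\times C_r(M;\mathbb{Z})\to\mathbb{Z}$ induces $\langle\cdot,\cdot\rangle:C^p_{\mathrm{grp}}(G;C^r(M;\mathbb{Z}))\times C^q_{\mathrm{grp}}(G;C_r(M;\mathbb{Z}))\to C^{p+q}_{\mathrm{grp}}(G;\mathbb{Z})$, $\langle a,b\rangle(g_1,\dots,g_{p+q})=\langle a(g_1,\dots,g_p),b(g_{p+1},\dots,g_{p+q})\rangle$. For $0\le k\le n$, $c_k=\langle\delta w_k,\Delta_k\rangle$. *)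

(* Defs.v *)
From HB Require Import structures.
From mathcomp Require Import freeg.
From mathcomp Require Import all_boot all_order all_algebra.
From mathcomp Require Import all_classical all_reals all_analysis.

Set Implicit Arguments.
Unset Strict Implicit.
Unset Printing Implicit Defensive.

Import Order.TTheory GRing.Theory Num.Theory.
Import numFieldNormedType.Exports.

Local Open Scope classical_set_scope.
Local Open Scope ring_scope.

(* [f] is [C^k] on some neighbourhood of [x]. *)
Fixpoint Ck_near (R : realType) (V W : normedModType R) (k : nat) (f : V -> W)
    (x : V) : Prop :=
  match k with
  | 0 => \forall y \near x, {for y, continuous f}
  | k'.+1 => (\forall y \near x, differentiable f y)
             /\ forall v, Ck_near k' ('D_v f) x
  end.

Definition smooth_at (R : realType) (V W : normedModType R) (f : V -> W)
    (x : V) : Prop :=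
  forall k, Ck_near k f x.

Section Calculus.
Context {R : realType}.

Lemma near_eq_differentiable (V W : normedModType R) (f g : V -> W) (x : V) :
  (\forall y \near x, f y = g y) -> differentiable f x -> differentiable g x.
Proof.
move=> fg /diff_locallyP[cf df].
have fgx : f x = g x by apply: nbhs_singleton fg.
have dE : g \o shift x = cst (g x) + 'd f x +o_ (0 : V) id.
  apply/eqaddoP => e e0.
  move/eqaddoP : df => /(_ e e0) df.
  have fg0 : \forall h \near (0 : V), f (h + x) = g (h + x).
    by move: fg; rewrite (near_shift 0) subr0.
  by apply: filterS2 fg0 df => h fgh; rewrite -fgx /GRing.add /GRing.opp /= fgh.
apply/diff_locallyP.
have dgE : 'd g x = 'd f x :> (V -> W) by exact: diff_unique cf dE.
by rewrite dgE.
Qed.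

Lemma Ck_near_eq (V W : normedModType R) k (f g : V -> W) (x : V) :
  (\forall y \near x, f y = g y) -> Ck_near k f x -> Ck_near k g x.
Proof.
elim: k f g => [|k IH] f g fg /=.
  move=> cf; have fg2 := near_join fg.
  near=> y.
  have yfg : \forall z \near y, f z = g z by near: y.
  have cfy : {for y, continuous f} by near: y.
  rewrite /prop_for /continuous_at -(nbhs_singleton yfg).
  by apply: cvg_trans cfy; apply: near_eq_cvg.
move=> [df Df]; split.
  have fg2 := near_join fg.
  near=> y.
  have yfg : \forall z \near y, f z = g z by near: y.
  by apply: near_eq_differentiable yfg _; near: y.
move=> v; apply: IH (Df v).
have fg2 := near_join fg.
near=> y; apply: near_eq_derive.
by near: y.
Unshelve. all: by end_near. Qed.

Lemma Ck_nearW (V W : normedModType R) k (f : V -> W) (x : V) :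
  Ck_near k.+1 f x -> Ck_near k f x.
Proof.
elim: k f => [|k IH] f [df Df].
  by apply: filterS df => y; exact: differentiable_continuous.
by split=> // v; apply: IH; exact: Df.
Qed.

Lemma Ck_near_cst (V W : normedModType R) k (a : W) (x : V) :
  Ck_near k (fun _ => a) x.
Proof.
elim: k a => [|k IH] a; first by apply: nearW => y; exact: cvg_cst.
split; first by apply: nearW => y; exact: differentiable_cst.
move=> v; rewrite (_ : 'D_v _ = fun=> 0) //.
by apply/funext => y; exact: derive_cst.
Qed.

Lemma Ck_nearD (V W : normedModType R) k (f g : V -> W) (x : V) :
  Ck_near k f x -> Ck_near k g x -> Ck_near k (fun y => f y + g y) x.
Proof.
elim: k f g => [|k IH] f g /=.
  by move=> cf cg; apply: filterS2 cf cg => y cf cg; exact: cvgD.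
move=> [df Df] [dg Dg]; split.
  by apply: filterS2 df dg => y df dg; exact: (@differentiableD _ _ _ f g).
move=> v; apply: Ck_near_eq (IH _ _ (Df v) (Dg v)).
apply: filterS2 df dg => y df dg; symmetry.
by apply: (@deriveD _ _ _ f g); exact: diff_derivable.
Qed.

Lemma Ck_near_sum (V W : normedModType R) k n (f : 'I_n -> V -> W) (x : V) :
  (forall i, Ck_near k (f i) x) -> Ck_near k (fun y => \sum_i f i y) x.
Proof.
elim: n f => [|n IH] f H.
  rewrite (_ : (fun _ => _) = fun=> 0); first exact: Ck_near_cst.
  by apply/funext => y; rewrite big_ord0.
rewrite (_ : (fun _ => _) = fun y => f ord0 y + \sum_i f (lift ord0 i) y).
  apply: Ck_nearD; first exact: H.
  by apply: (IH (fun i => f (lift ord0 i))).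
by apply/funext => y; rewrite big_ord_recl.
Qed.

Lemma Ck_nearM (V : normedModType R) k (f g : V -> R) (x : V) :
  Ck_near k f x -> Ck_near k g x -> Ck_near k (fun y => f y * g y) x.
Proof.
elim: k f g => [|k IH] f g.
  by move=> cf cg; apply: filterS2 cf cg => y cf cg; exact: cvgM.
move=> kf kg; have [df Df] := kf; have [dg Dg] := kg; split.
  by apply: filterS2 df dg => y df dg; exact: (@differentiableM _ _ f g).
move=> v.
have := Ck_nearD (IH _ _ (Ck_nearW kf) (Dg v)) (IH _ _ (Ck_nearW kg) (Df v)).
apply: Ck_near_eq.
apply: filterS2 df dg => y df dg; symmetry.
by apply: (@deriveM _ _ f g); exact: diff_derivable.
Qed.

Lemma Ck_near_coord (V : normedModType R) k m (f : V -> 'rV[R]_m) (x : V) j :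
  Ck_near k f x -> Ck_near k (fun y => f y 0 j) x.
Proof.
elim: k f => [|k IH] f.
  apply: filterS => y cf.
  exact: (@continuous_comp _ _ _ f (fun z : 'rV_m => z 0 j) y cf
           (@coord_continuous _ _ _ _ _ _)).
move=> [df Df]; split.
  apply: filterS df => y dfy.
  exact: (@differentiable_comp _ _ _ _ f (fun z : 'rV_m => z 0 j) y dfy
           (differentiable_coord _ _ _)).
move=> v; apply: Ck_near_eq (IH _ (Df v)).
apply: filterS df => y dfy.
by rewrite derive_mx ?mxE//; exact: diff_derivable.
Qed.

Lemma derive_comp_rV (V W : normedModType R) m (f : V -> 'rV[R]_m)
    (g : 'rV[R]_m -> W) (x v : V) :
  differentiable f x -> differentiable g (f x) ->
  'D_v (g \o f) x = 'D_('D_v f x) g (f x).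
Proof.
move=> df dg; rewrite deriveE; last exact: differentiable_comp.
by rewrite diff_comp// /= (deriveE _ dg) (deriveE _ df).
Qed.

Lemma Ck_near_comp_real (V : normedModType R) k m (f : V -> 'rV[R]_m)
    (g : 'rV[R]_m -> R) (x : V) :
  Ck_near k f x -> Ck_near k g (f x) -> Ck_near k (g \o f) x.
Proof.
elim: k f g => [|k IH] f g.
  move=> cf cg; have := nbhs_singleton cf => /(_ _ cg) cgf.
  by apply: filterS2 cf cgf => y cfy cgy; exact: continuous_comp.
move=> kf kg; have [df Df] := kf; have [dg Dg] := kg.
have dgf : \forall y \near x, differentiable g (f y).
  exact: (differentiable_continuous (nbhs_singleton df) dg).
split.
  by apply: filterS2 df dgf => y dfy dgy; exact: differentiable_comp.
move=> v.
have H : Ck_near k (fun y => \sum_j 'D_v f y 0 j * ('D_(delta_mx 0 j) g \o f) y) x.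
  apply: Ck_near_sum => j; apply: Ck_nearM; first exact/Ck_near_coord/Df.
  by apply: IH (Dg _); exact: Ck_nearW.
apply: Ck_near_eq H.
apply: filterS2 df dgf => y dfy dgy.
rewrite derive_comp_rV// (deriveE ('D_v f y))// [in RHS](row_sum_delta ('D_v f y)).
rewrite linear_sum; apply: eq_bigr => j _.
by rewrite linearZ /= (deriveE _ dgy).
Qed.

Lemma differentiable_rV (V : normedModType R) m (f : V -> 'rV[R]_m) x :
  (forall j, differentiable (fun y => f y 0 j) x) -> differentiable f x.
Proof.
move=> H.
rewrite (_ : f = \sum_j (fun y => f y 0 j *: delta_mx 0 j)); last first.
  by apply/funext => y; rewrite fct_sumE [LHS]row_sum_delta.
apply: differentiable_sum => j.
exact: differentiableZl.
Qed.

Lemma continuous_rV (T : topologicalType) m (f : T -> 'rV[R]_m) (y : T) :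
  (forall j, {for y, continuous (fun z => f z 0 j)}) -> {for y, continuous f}.
Proof.
move=> Hy; apply/cvgrPdist_lt => e e0.
have H : \forall z \near y, forall j, `|f y 0 j - f z 0 j| < e.
  by apply: filter_forall => j; move/cvgrPdist_lt: (Hy j) => /(_ e e0).
apply: filterS H => z Hz.
rewrite [ltLHS]/Num.Def.normr/= mx_normrE; apply: bigmax_lt => // -[i j] _.
by rewrite !mxE ord1; exact: Hz.
Qed.

Lemma Ck_near_rV (V : normedModType R) k m (f : V -> 'rV[R]_m) (x : V) :
  (forall j, Ck_near k (fun y => f y 0 j) x) -> Ck_near k f x.
Proof.
elim: k f => [|k IH] f H.
  have H' : \forall y \near x, forall j, {for y, continuous (fun z => f z 0 j)}.
    apply: filter_forall => j; exact: H.
  by apply: filterS H' => y; exact: continuous_rV.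
have df : \forall y \near x, forall j, differentiable (fun z => f z 0 j) y.
  by apply: filter_forall => j; have [] := H j.
split.
  by apply: filterS df => y; exact: differentiable_rV.
move=> v; apply: IH => j.
have [_ Dj] := H j.
apply: Ck_near_eq (Dj v).
apply: filterS df => y dfy.
by rewrite derive_mx ?mxE//; apply: diff_derivable; exact: differentiable_rV.
Qed.

Lemma smooth_at_eq (V W : normedModType R) (f g : V -> W) (x : V) :
  (\forall y \near x, f y = g y) -> smooth_at f x -> smooth_at g x.
Proof. by move=> fg sf k; exact: Ck_near_eq (sf k). Qed.

Lemma smooth_at_comp (V : normedModType R) m q (f : V -> 'rV[R]_m)
    (g : 'rV[R]_m -> 'rV[R]_q) (x : V) :
  smooth_at f x -> smooth_at g (f x) -> smooth_at (g \o f) x.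
Proof.
move=> sf sg k; apply: Ck_near_rV => j.
exact: (Ck_near_comp_real (g := fun y => g y 0 j) (sf k) (Ck_near_coord j (sg k))).
Qed.

Lemma smooth_at_differentiable (V W : normedModType R) (f : V -> W) (x : V) :
  smooth_at f x -> differentiable f x.
Proof. by move=> /(_ 1%N) [] /nbhs_singleton. Qed.

Lemma smooth_at_id (V : normedModType R) (x : V) : smooth_at id x.
Proof.
case=> [|k]; first by apply: nearW => y; exact: cvg_id.
split; first by apply: nearW => y; exact: ex_diff.
move=> v; rewrite (_ : 'D_v _ = fun=> v); first exact: Ck_near_cst.
by apply/funext => y; exact: derive_id.
Qed.

End Calculus.

(* A smooth (C^oo) manifold of dimension [m], without boundary: a Hausdorff,
   second countable space with a C^oo atlas.  The maps [chart i] and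
   [chart_inv i] are total; only their values on [chart_dom i] and on
   [chart i @` chart_dom i] are meaningful. *)
Record manifold (R : realType) (m : nat) := Manifold {
  manifold_sort :> topologicalType;
  manifold_hausdorff : hausdorff_space manifold_sort;
  manifold_second_countable : @second_countable manifold_sort;
  chart_index : Type;
  chart_dom : chart_index -> set manifold_sort;
  chart : chart_index -> manifold_sort -> 'rV[R]_m;
  chart_inv : chart_index -> 'rV[R]_m -> manifold_sort;
  chart_at : manifold_sort -> chart_index;
  chart_at_dom : forall x, chart_dom (chart_at x) x;
  chart_dom_open : forall i, open (chart_dom i);
  chart_image_open : forall i, open (chart i @` chart_dom i);
  chartK : forall i x, chart_dom i x -> chart_inv i (chart i x) = x;
  chart_continuous : forall i x, chart_dom i x -> {for x, continuous (chart i)};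
  chart_inv_continuous : forall i x, chart_dom i x ->
    {for chart i x, continuous (chart_inv i)};
  transition_smooth : forall i j x, chart_dom i x -> chart_dom j x ->
    smooth_at (chart j \o chart_inv i) (chart i x)
}.

Section Manifolds.
Context {R : realType} {m : nat} {M : manifold R m}.

Definition smooth_into (p : nat) (F : 'rV[R]_p -> M) (y : 'rV[R]_p) : Prop :=
  {for y, continuous F} /\
  forall j, chart_dom j (F y) -> smooth_at (chart j \o F) y.

Definition smooth_map (f : M -> M) : Prop :=
  forall i x, chart_dom i x -> smooth_into (f \o chart_inv i) (chart i x).

(* A differential [n]-form is given by its local expressions in the charts:
   [Omega i y] is an alternating [n]-linear form on R^m for each [y] in the
   image of the chart [i], and the expressions in two charts correspond under
   pullback along the change of charts.  The derivative of a smooth map [F] at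
   [y] applied to the vector [v] is ['D_v F y]. *)
Record dform (n : nat) := DForm {
  dform_fun :> chart_index M -> 'rV[R]_m -> ('I_n -> 'rV[R]_m) -> R;
  dform_multilinear : forall i x, chart_dom i x ->
    forall (v : 'I_n -> 'rV[R]_m) (a : 'I_n) (c : R) (u w : 'rV[R]_m),
      dform_fun i (chart i x) (fun b => if b == a then c *: u + w else v b) =
      c * dform_fun i (chart i x) (fun b => if b == a then u else v b) +
      dform_fun i (chart i x) (fun b => if b == a then w else v b);
  dform_alternating : forall i x, chart_dom i x ->
    forall (v : 'I_n -> 'rV[R]_m) (a b : 'I_n), a != b -> v a = v b ->
      dform_fun i (chart i x) v = 0;
  dform_smooth : forall i x, chart_dom i x ->
    forall v : 'I_n -> 'rV[R]_m,
      smooth_at (fun y => dform_fun i y v) (chart i x);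
  dform_transition : forall i j x, chart_dom i x -> chart_dom j x ->
    forall v : 'I_n -> 'rV[R]_m,
      dform_fun j (chart j x)
        (fun a => 'D_(v a) (chart j \o chart_inv i) (chart i x)) =
      dform_fun i (chart i x) v
}.

(* d Omega (v_0, ..., v_n) for constant vector fields v_k in the chart [i]. *)
Definition ext_derivative n (Omega : dform n) (i : chart_index M)
    (y : 'rV[R]_m) (v : 'I_n.+1 -> 'rV[R]_m) : R :=
  \sum_(k < n.+1) (-1) ^+ k *
    'D_(v k) (fun z => Omega i z (fun a => v (lift k a))) y.

Definition closed_form n (Omega : dform n) : Prop :=
  forall i x, chart_dom i x -> forall v, ext_derivative Omega i (chart i x) v = 0.

(* (F^* Omega)_y (v_1, ..., v_n); by [pullback_atE] below, it does not depend on
   the chart used around [F y]. *)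
Definition pullback_at n (Omega : dform n) p (F : 'rV[R]_p -> M)
    (y : 'rV[R]_p) (v : 'I_n -> 'rV[R]_p) : R :=
  let j := chart_at (F y) in
  Omega j (chart j (F y)) (fun a => 'D_(v a) (chart j \o F) y).

Definition preserves_form n (Omega : dform n) (f : M -> M) : Prop :=
  forall i x, chart_dom i x -> forall v,
    pullback_at Omega (f \o chart_inv i) (chart i x) v = Omega i (chart i x) v.

Lemma near_into p (F : 'rV[R]_p -> M) y j :
  {for y, continuous F} -> chart_dom j (F y) ->
  \forall z \near y, chart_dom j (F z).
Proof.
move=> cF jF; apply: cF; apply: open_nbhs_nbhs; split => //.
exact: chart_dom_open.
Qed.

Lemma near_chart_change p (F : 'rV[R]_p -> M) y i (h : M -> 'rV[R]_m) :
  {for y, continuous F} -> chart_dom i (F y) ->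
  \forall z \near y, ((h \o chart_inv i) \o (chart i \o F)) z = (h \o F) z.
Proof.
move=> cF iF; apply: filterS (near_into cF iF) => z iz.
by rewrite /= chartK.
Qed.

Lemma smooth_into_differentiable p (F : 'rV[R]_p -> M) y j :
  smooth_into F y -> chart_dom j (F y) -> differentiable (chart j \o F) y.
Proof. by move=> [_ sF] jF; apply: smooth_at_differentiable; exact: sF. Qed.

Lemma smooth_into_comp p (F : 'rV[R]_p -> M) y (f : M -> M) :
  smooth_map f -> smooth_into F y -> smooth_into (f \o F) y.
Proof.
move=> sf [cF sF].
set i := chart_at (F y).
have iF : chart_dom i (F y) by exact: chart_at_dom.
have [cfi sfi] := sf _ _ iF.
have ciF : {for y, continuous (chart i \o F)}.
  by apply: continuous_comp => //; exact: chart_continuous.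
split.
  have E : \forall z \near y, ((f \o chart_inv i) \o (chart i \o F)) z = (f \o F) z.
    by apply: filterS (near_into cF iF) => z iz; rewrite /= chartK.
  rewrite /prop_for /continuous_at -(nbhs_singleton E).
  apply: cvg_trans (near_eq_cvg E) _.
  by apply: continuous_comp.
move=> j jfF.
apply: (smooth_at_eq (near_chart_change (chart j \o f) cF iF)).
apply: smooth_at_comp; first exact: sF.
apply: sfi; by rewrite /= chartK.
Qed.

Lemma smooth_map_comp (f g : M -> M) :
  smooth_map f -> smooth_map g -> smooth_map (g \o f).
Proof. by move=> sf sg i x ix; apply: (smooth_into_comp sg); exact: sf. Qed.

Lemma smooth_into_inv (i : chart_index M) x : chart_dom i x -> smooth_into (chart_inv i) (chart i x).
Proof.
move=> ix; split; first exact: chart_inv_continuous.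
by rewrite chartK// => j jx; exact: transition_smooth.
Qed.

Lemma smooth_map_id : smooth_map id.
Proof. by move=> i x ix; exact: smooth_into_inv. Qed.

Lemma smooth_map_continuous (f : M -> M) : smooth_map f -> continuous f.
Proof.
move=> sf x.
set i := chart_at x.
have ix : chart_dom i x by exact: chart_at_dom.
have [cfi _] := sf _ _ ix.
have E : \forall z \near x, ((f \o chart_inv i) \o chart i) z = f z.
  have : nbhs x (chart_dom i).
    by apply: open_nbhs_nbhs; split => //; exact: chart_dom_open.
  by apply: filterS => z iz; rewrite /= chartK.
rewrite /continuous_at -(nbhs_singleton E).
apply: cvg_trans (near_eq_cvg E) _.
by apply: continuous_comp => //; exact: chart_continuous.
Qed.

Lemma pullback_atE n (Omega : dform n) p (F : 'rV[R]_p -> M) y j v :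
  smooth_into F y -> chart_dom j (F y) ->
  pullback_at Omega F y v =
  Omega j (chart j (F y)) (fun a => 'D_(v a) (chart j \o F) y).
Proof.
move=> sF jF; rewrite /pullback_at.
set i := chart_at (F y).
have iF : chart_dom i (F y) by exact: chart_at_dom.
rewrite -(dform_transition Omega iF jF); congr (Omega j _ _).
apply/funext => a.
rewrite -(near_eq_derive _ (near_chart_change (chart j) sF.1 iF)).
rewrite derive_comp_rV//; first exact: smooth_into_differentiable.
by apply: smooth_at_differentiable; exact: transition_smooth.
Qed.

Lemma pullback_at_comp n (Omega : dform n) p (F : 'rV[R]_p -> M) y (f : M -> M) v :
  smooth_map f -> preserves_form Omega f -> smooth_into F y ->
  pullback_at Omega (f \o F) y v = pullback_at Omega F y v.
Proof.
move=> sf pf sF.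
set i := chart_at (F y).
have iF : chart_dom i (F y) by exact: chart_at_dom.
set j := chart_at (f (F y)).
have jF : chart_dom j (f (F y)) by exact: chart_at_dom.
have jF' : chart_dom j ((f \o chart_inv i) (chart i (F y))) by rewrite /= chartK.
rewrite (pullback_atE _ _ sF iF) -(pf _ _ iF).
rewrite (pullback_atE _ _ (smooth_into_comp sf sF) jF).
rewrite (pullback_atE _ _ (sf _ _ iF) jF') /= chartK//.
congr (Omega j _ _); apply/funext => a.
rewrite -(near_eq_derive _ (near_chart_change (chart j \o f) sF.1 iF)).
rewrite derive_comp_rV//; first exact: smooth_into_differentiable.
exact: (smooth_into_differentiable (sf _ _ iF) jF').
Qed.

Lemma pullback_at_inv n (Omega : dform n) i x v : chart_dom i x ->
  pullback_at Omega (chart_inv i) (chart i x) v = Omega i (chart i x) v.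
Proof.
move=> ix; rewrite (pullback_atE _ _ (smooth_into_inv ix) (j := i)) chartK//.
exact: dform_transition.
Qed.

Lemma preserves_form_id n (Omega : dform n) : preserves_form Omega id.
Proof. by move=> i x ix v; exact: pullback_at_inv. Qed.

Lemma preserves_form_comp n (Omega : dform n) (f g : M -> M) :
  smooth_map f -> smooth_map g -> preserves_form Omega f ->
  preserves_form Omega g -> preserves_form Omega (g \o f).
Proof.
move=> sf sg pf pg i x ix v.
by rewrite -(pf _ _ ix v); exact: (pullback_at_comp v sg pg (sf _ _ ix)).
Qed.

Lemma preserves_form_inv n (Omega : dform n) (f g : M -> M) :
  smooth_map f -> smooth_map g -> cancel g f -> preserves_form Omega f ->
  preserves_form Omega g.
Proof.
move=> sf sg gK pf i x ix v.
rewrite -(pullback_at_comp v sf pf (sg _ _ ix)) -(pullback_at_inv Omega v ix).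
by congr (pullback_at _ _ _ _); apply/funext => y /=.
Qed.

End Manifolds.
Arguments dform {R m} M n.

(* Diff_Omega(M).  The inverse is determined by the underlying map, see
   [diff_form_eq]; the group law is composition, (f * g)(x) = f (g x). *)
Record diff_form (R : realType) (m : nat) (M : manifold R m) (n : nat)
    (Omega : dform M n) := DiffForm {
  diffeo_fun :> M -> M;
  diffeo_inv : M -> M;
  diffeo_funK : cancel diffeo_fun diffeo_inv;
  diffeo_invK : cancel diffeo_inv diffeo_fun;
  diffeo_fun_smooth : smooth_map diffeo_fun;
  diffeo_inv_smooth : smooth_map diffeo_inv;
  diffeo_preserves : preserves_form Omega diffeo_fun
}.

Arguments diffeo_funK {R m M n Omega} d : rename.
Arguments diffeo_invK {R m M n Omega} d : rename.
Arguments diffeo_preserves {R m M n Omega} d : rename.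

Section DiffGroup.
Context {R : realType} {m : nat} {M : manifold R m} {n : nat}.
Variable Omega : dform M n.
Local Notation G := (diff_form Omega).

HB.instance Definition _ := gen_eqMixin G.
HB.instance Definition _ := gen_choiceMixin G.

Lemma diff_form_eq (f g : G) : (forall x, f x = g x) -> f = g.
Proof.
case: f g => [f f' fK f'K sf sf' pf] [g g' gK g'K sg sg' pg] /= fg.
have {}fg : f = g by exact/funext.
have fg' : f' = g'.
  by apply/funext => x; rewrite -[in LHS](g'K x) -fg fK.
by subst g g'; congr DiffForm; exact: Prop_irrelevance.
Qed.

Definition diff_form_one : G :=
  DiffForm (fun=> erefl) (fun=> erefl) smooth_map_id smooth_map_id
    (preserves_form_id Omega).

Definition diff_form_inv (f : G) : G :=
  DiffForm (diffeo_invK f) (diffeo_funK f)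
    (diffeo_inv_smooth f) (diffeo_fun_smooth f)
    (preserves_form_inv (diffeo_fun_smooth f) (diffeo_inv_smooth f)
       (diffeo_invK f) (diffeo_preserves f)).

Definition diff_form_mul (f g : G) : G :=
  DiffForm (can_comp (diffeo_funK f) (diffeo_funK g))
    (can_comp (diffeo_invK g) (diffeo_invK f))
    (smooth_map_comp (diffeo_fun_smooth g) (diffeo_fun_smooth f))
    (smooth_map_comp (diffeo_inv_smooth f) (diffeo_inv_smooth g))
    (preserves_form_comp (diffeo_fun_smooth g) (diffeo_fun_smooth f)
       (diffeo_preserves g) (diffeo_preserves f)).

Lemma diff_form_mulA : associative diff_form_mul.
Proof. by move=> f g h; exact: diff_form_eq. Qed.

Lemma diff_form_mul1 : left_id diff_form_one diff_form_mul.
Proof. by move=> f; exact: diff_form_eq. Qed.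

Lemma diff_form_mulr1 : right_id diff_form_one diff_form_mul.
Proof. by move=> f; exact: diff_form_eq. Qed.

Lemma diff_form_mulV : left_inverse diff_form_one diff_form_inv diff_form_mul.
Proof. by move=> f; apply: diff_form_eq => x; exact: diffeo_funK. Qed.

Lemma diff_form_mulrV : right_inverse diff_form_one diff_form_inv diff_form_mul.
Proof. by move=> f; apply: diff_form_eq => x; exact: diffeo_invK. Qed.

HB.instance Definition _ := isGroup.Build G diff_form_mulA diff_form_mul1
  diff_form_mulr1 diff_form_mulV diff_form_mulrV.

Definition diffeo_cts (f : G) : continuousType M M :=
  mkcts (smooth_map_continuous (diffeo_fun_smooth f)).

End DiffGroup.

(* The standard [p]-simplex in barycentric coordinates; as a type, it carries the
   subspace topology. *)
Definition std_simplex (R : realType) (p : nat) : set 'rV[R]_p.+1 :=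
  [set x | (forall i, 0 <= x 0 i) /\ \sum_i x 0 i = 1].
Arguments std_simplex R p : clear implicits.

Section Simplices.
Context {R : realType}.

(* The [i]-th face inclusion inserts a zero in position [i]. *)
Definition face_row p (i : 'I_p.+2) (x : 'rV[R]_p.+1) : 'rV[R]_p.+2 :=
  \row_j oapp (x 0) 0 (unlift i j).

Lemma face_row_simplex p (i : 'I_p.+2) (x : std_simplex R p) :
  face_row i (\val x) \in std_simplex R p.+1.
Proof.
case: x => x /= /[!inE] -[x0 x1]; split.
  by move=> j; rewrite mxE; case: unlift => //=.
rewrite (bigD1_ord i)//= mxE unlift_none /= add0r -[RHS]x1.
by apply: eq_bigr => j _; rewrite mxE liftK.
Qed.

Definition face_fun p (i : 'I_p.+2) (x : std_simplex R p) : std_simplex R p.+1 :=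
  
  @exist _ (fun y => y \in std_simplex R p.+1) _ (face_row_simplex i x).

Lemma face_continuous p (i : 'I_p.+2) : continuous (@face_fun p i).
Proof.
apply: continuous_comp_initial => x.
have : {for x, continuous (fun z : std_simplex R p => face_row i (\val z))}; last by [].
apply: continuous_rV => j.
rewrite (_ : (fun _ => _) =
    fun z : std_simplex R p => oapp ((\val z : 'rV[R]_p.+1) 0) 0 (unlift i j)).
  case: unlift => [k|] /=; last exact: (@cst_continuous _ _ (0 : R) x).
  apply: (@continuous_comp _ _ _ _ (fun y : 'rV[R]_p.+1 => y 0 k)).
    exact: initial_continuous.
  exact: coord_continuous.
by apply/funext => z /=; rewrite mxE.
Qed.

Definition face p (i : 'I_p.+2) :
    continuousType (std_simplex R p) (std_simplex R p.+1) :=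
  mkcts (@face_continuous p i).

Lemma vertex_simplex p (k : 'I_p.+1) :
  (delta_mx 0 k : 'rV[R]_p.+1) \in std_simplex R p.
Proof.
rewrite inE; split => [i|]; first by rewrite mxE ler0n.
rewrite (bigD1 k)//= mxE !eqxx big1 ?addr0// => i ik.
by rewrite mxE (negbTE ik) andbF.
Qed.

Definition vertex p (k : 'I_p.+1) : std_simplex R p :=
  @exist _ (fun y => y \in std_simplex R p) _ (vertex_simplex k).

End Simplices.

Section SingularComplex.
Context {R : realType} {m : nat}.
Variable M : manifold R m.

Definition sing p := continuousType (std_simplex R p) M.
Definition sing_chain p := {freeg (sing p) / int}.
(* A homomorphism from the free group of [p]-chains to [A] is the same thing as
   a function on singular [p]-simplices; [sing_eval] is the evaluation pairing. *)
Definition sing_cochain (A : Type) p := sing p -> A.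

Definition sing_face p (i : 'I_p.+2) (s : sing p.+1) : sing p := s \o face i.

Definition simplex_chain p (s : sing p) : sing_chain p := Freeg [:: (1, s)].

Definition point_chain (x : M) : sing_chain 0 := simplex_chain (cst x : sing 0).

Definition sing_boundary p : sing_chain p.+1 -> sing_chain p :=
  fglift (fun s => \sum_(i < p.+2) (-1) ^+ i *: simplex_chain (sing_face i s)).

Definition sing_d (A : nzRingType) p (u : sing_cochain A p) :
    sing_cochain A p.+1 :=
  fun s => \sum_(i < p.+2) (-1) ^+ i * u (sing_face i s).

Definition sing_eval p (u : sing_cochain int p) (z : sing_chain p) : int :=
  fglift (u : sing p -> int^o) z.

Definition sing_cycle p : sing_chain p -> Prop :=
  match p with
  | 0 => fun _ => True
  | p'.+1 => fun z => sing_boundary z = 0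
  end.

Definition homology_trivial p : Prop :=
  forall z : sing_chain p, sing_cycle z -> exists y, sing_boundary y = z.

Definition push_simplex p (f : continuousType M M) (s : sing p) : sing p :=
  f \o s.

Definition push_chain p (f : continuousType M M) : sing_chain p -> sing_chain p :=
  fglift (fun s => simplex_chain (push_simplex f s)).

Definition pull_cochain A p (u : sing_cochain A p) (f : continuousType M M) :
    sing_cochain A p :=
  fun s => u (push_simplex f s).

End SingularComplex.

Section DeRham.
Context {R : realType} {m : nat} {M : manifold R m}.

(* A singular simplex is smooth when it extends to a smooth map on an open
   neighbourhood of the standard simplex in R^(p+1). *)
Definition smooth_simplex p (s : sing M p) : Prop :=
  exists F : 'rV[R]_p.+1 -> M, exists U : set 'rV[R]_p.+1,
    [/\ open U, std_simplex R p `<=` U, forall y, U y -> smooth_into F y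
      & forall y : std_simplex R p, F (\val y) = s y].

(* Iterated Lebesgue integral of [f [:: t_1; ...; t_n]] over the simplex
   t_1, ..., t_n >= 0, t_1 + ... + t_n <= a. *)
Fixpoint simplex_integral (n : nat) (a : R) (f : seq R -> R) : R :=
  match n with
  | 0 => f [::]
  | n'.+1 => \int[lebesgue_measure]_(t in `[0, a])
               simplex_integral n' (a - t) (fun l => f (t :: l))
  end.

Definition simplex_point n (l : seq R) : 'rV[R]_n.+1 :=
  \row_i ((1 - \sum_(t <- l) t) :: l)`_i.

(* The integral of the pullback of [Omega] along [s], in the coordinates
   (t_1, ..., t_n) |-> (1 - t_1 - ... - t_n, t_1, ..., t_n) of the standard simplex,
   whose partial derivatives are e_a - e_0.  The map [s] is extended arbitrarily
   outside of the simplex: at an interior point, directional derivatives along the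
   vectors e_a - e_0 only involve values on the simplex. *)
Definition form_integral n (Omega : dform M n) (s : sing M n) : R :=
  simplex_integral n 1 (fun l =>
    pullback_at Omega (valL_ (s (vertex ord0)) s) (simplex_point n l)
      (fun a => delta_mx 0 (lift ord0 a) - delta_mx 0 ord0)).

(* The restriction of [u] to smooth singular simplices is the coboundary of a
   cochain on smooth singular simplices. *)
Definition smooth_exact p : (sing M p -> R) -> Prop :=
  match p with
  | 0 => fun u => forall s, smooth_simplex s -> u s = 0
  | p'.+1 => fun u => exists eta : sing M p' -> R,
      forall s, smooth_simplex s -> u s = sing_d eta s
  end.

(* The class [Omega] in H^n(M; R), as the set of the singular cocycles which
   represent it.  It is the preimage of the class of s |-> \int_s Omega under the
   isomorphism H^n(M; R) -> H^n_smooth(M; R) given by restriction to smooth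
   singular simplices (de Rham's theorem). *)
Definition deRham_class n (Omega : dform M n) : set (sing_cochain M R n) :=
  [set u | sing_d u = 0 /\ smooth_exact (fun s => u s - form_integral Omega s)].

(* [u] is an integral cocycle whose class is mapped to [Omega] by
   H^n(M; Z) -> H^n(M; R). *)
Definition integral_class n (Omega : dform M n) (u : sing_cochain M int n) : Prop :=
  sing_d u = 0 /\ deRham_class Omega (fun s => (u s)%:~R).

End DeRham.

Section GroupCochains.
Context {G : groupType}.

Definition group_cochain (A : Type) p := ('I_p -> G) -> A.

Definition cast_cochain (A : Type) p q (e : p = q) (c : group_cochain A p) :
    group_cochain A q :=
  fun g => c (fun i => g (cast_ord e i)).

Definition drop_first p (g : 'I_p.+1 -> G) : 'I_p -> G :=
  fun j => g (lift ord0 j).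

Definition drop_last p (g : 'I_p.+1 -> G) : 'I_p -> G :=
  fun j => g (lift ord_max j).

(* (g_1, ..., g_i g_(i+1), ..., g_(p+1)), with indices shifted to start from 0. *)
Definition merge_at p (i : 'I_p) (g : 'I_p.+1 -> G) : 'I_p -> G :=
  fun j => if (j < i)%N then g (widen_ord (leqnSn p) j)
           else if j == i then (g (widen_ord (leqnSn p) j) * g (lift ord0 j))%g
           else g (lift ord0 j).

Definition left_module (A : zmodType) (act : G -> A -> A) : Prop :=
  [/\ forall a, act 1%g a = a, forall g h a, act (g * h)%g a = act g (act h a)
    & forall g a b, act g (a + b) = act g a + act g b].

Definition right_module (A : zmodType) (act : A -> G -> A) : Prop :=
  [/\ forall a, act a 1%g = a, forall g h a, act a (g * h)%g = act (act a g) h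
    & forall g a b, act (a + b) g = act a g + act b g].

Definition delta_left (A : zmodType) (act : G -> A -> A) p
    (c : group_cochain A p) : group_cochain A p.+1 :=
  fun g => act (g ord0) (c (drop_first g))
         + \sum_(i < p) c (merge_at i g) *~ (-1) ^+ i.+1
         + c (drop_last g) *~ (-1) ^+ p.+1.

Definition delta_right (A : zmodType) (act : A -> G -> A) p
    (c : group_cochain A p) : group_cochain A p.+1 :=
  fun g => c (drop_first g)
         + \sum_(i < p) c (merge_at i g) *~ (-1) ^+ i.+1
         + act (c (drop_last g)) (g ord_max) *~ (-1) ^+ p.+1.

Definition trivial_act (A : Type) (g : G) (a : A) : A := a.

Definition cocycle p (c : group_cochain int p) : Prop :=
  delta_left (@trivial_act int) c = fun=> 0.

Definition cohomologous p (c c' : group_cochain int p.+1) : Prop :=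
  exists b : group_cochain int p,
    delta_left (@trivial_act int) b = fun g => c g - c' g.

Lemma trivial_left_module (A : zmodType) : left_module (@trivial_act A).
Proof. by split. Qed.

End GroupCochains.
Arguments group_cochain G A p : clear implicits.

Section Cochains.
Context {R : realType} {m : nat} {M : manifold R m} {n : nat}.
Context {Omega : dform M n}.
Local Notation G := (diff_form Omega).

Definition push p (g : G) (z : sing_chain M p) : sing_chain M p :=
  push_chain (diffeo_cts g) z.

Definition pull A p (u : sing_cochain M A p) (g : G) : sing_cochain M A p :=
  pull_cochain u (diffeo_cts g).

Lemma chain_ext (M' : manifold R m) p (W : zmodType) (f g : sing_chain M' p -> W) :
  (forall a b, f (a + b) = f a + f b) -> (forall a b, g (a + b) = g a + g b) ->
  (forall s, f (simplex_chain s) = g (simplex_chain s)) -> forall z, f z = g z.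
Proof.
move=> fD gD fg z.
have add0 (h : sing_chain M' p -> W) :
    (forall a b, h (a + b) = h a + h b) -> zmod_morphism h.
  move=> hD a b; apply: (addIr (h b)).
  by rewrite -hD !subrK.
pose fa : {additive _ -> _} := HB.pack f (GRing.isZmodMorphism.Build _ _ f (add0 _ fD)).
pose ga : {additive _ -> _} := HB.pack g (GRing.isZmodMorphism.Build _ _ g (add0 _ gD)).
rewrite -(freeg_sumE z) -[LHS]/(fa _) -[RHS]/(ga _) !raddf_sum.
apply: eq_bigr => s _.
rewrite -[coeff s z]intz -freegU_mulz !raddfMz; congr (_ *~ _).
exact: fg.
Qed.

Lemma fgliftD (K : choiceType) (W : lmodType int) (f : K -> W) a b :
  fglift f (a + b) = fglift f a + fglift f b.
Proof.
have H := lift_is_additive f.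
have H0 : fglift f 0 = 0 by rewrite -(subrr 0) H subrr.
by rewrite -[b in LHS]opprK H -[- b]sub0r H H0 sub0r opprK.
Qed.

Lemma push_chain_simplex p f (s : sing M p) :
  push_chain f (simplex_chain s) = simplex_chain (push_simplex f s).
Proof. by rewrite /push_chain liftU scale1r. Qed.

Lemma push_left_module p : left_module (@push p).
Proof.
have pushD g (a b : sing_chain M p) : push g (a + b) = push g a + push g b.
  exact: fgliftD.
split=> //.
- apply: chain_ext => // s; rewrite /push push_chain_simplex.
  by congr simplex_chain; exact/continuousEP.
- move=> g h; apply: chain_ext; [by move=> a b; rewrite pushD| |].
    by move=> a b; rewrite !pushD.
  move=> s; rewrite /push !push_chain_simplex.
  by congr simplex_chain; exact/continuousEP.
Qed.

Lemma pull_right_module (A : zmodType) p : right_module (@pull A p).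
Proof.
split=> //.
- move=> u; apply/funext => s; rewrite /pull /pull_cochain; congr u.
  exact/continuousEP.
- move=> g h u; apply/funext => s; rewrite /pull /pull_cochain; congr u.
  exact/continuousEP.
Qed.

Definition pairing k p q (a : group_cochain G (sing_cochain M int k) p)
    (b : group_cochain G (sing_chain M k) q) : group_cochain G int (p + q) :=
  fun g => sing_eval (a (fun i => g (lshift q i))) (b (fun j => g (rshift p j))).

Lemma c_degree k : (k <= n)%N -> ((n - k).+1 + k = n.+1)%N.
Proof. by move=> kn; rewrite addSn subnK. Qed.

Lemma w_degree k : (k < n)%N -> (n - k = (n - k.+1).+1)%N.
Proof. by move=> kn; rewrite subnSK. Qed.

Definition c_cochain
    (w : forall k, group_cochain G (sing_cochain M int k) (n - k))
    (D : forall k, group_cochain G (sing_chain M k) k)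
    k (kn : (k <= n)%N) : group_cochain G int n.+1 :=
  cast_cochain (c_degree kn)
    (pairing (delta_right (@pull int k) (w k)) (D k)).

End Cochains.

(* Main.v *)
Require Import Defs.
From HB Require Import structures.
From mathcomp Require Import freeg.
From mathcomp Require Import all_boot all_order all_algebra.
From mathcomp Require Import all_classical all_reals all_analysis.
From mathcomp Require Import zify.
Import Order.TTheory GRing.Theory Num.Theory.
Import numFieldNormedType.Exports.
Local Open Scope classical_set_scope.
Local Open Scope ring_scope.

(** The pairing of cochains with values in singular cochains and in singular
    chains is balanced, <u g, z> = <u, g z>, so it satisfies the Leibniz rule
    delta <a, b> = <delta a, b> + (-1)^p <a, delta b> for [a] of degree [p].
    Moreover [sing_d] is adjoint to [sing_boundary].  The theorem is a formal
    consequence of these two facts and of the relations between the [w k] and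
    the [Delta k].

    Cohomologous: by the Leibniz rule, delta <w_k, Delta_k> is the sum of c_k
    and of (-1)^(n-k) <w_k, delta Delta_k>, where
    <w_k, delta Delta_k> = <w_k, partial Delta_(k+1)> = <d w_k, Delta_(k+1)>.
    The relation delta w_(k+1) = - (-1)^(n-k) d w_k turns the second summand
    into - c_(k+1).  Hence c_k - c_(k+1) is a coboundary ([c_cochain_succ]), and
    all the c_k are cohomologous to c_0.

    Cocycles: it is then enough to treat c_0 ([c_cochain0_cocycle]).  By the
    Leibniz rule, delta c_0 is the sum of <delta delta w_0, Delta_0> = 0 and of
    a multiple of
    <delta w_0, delta Delta_0> = <delta w_0, partial Delta_1>
    = <d delta w_0, Delta_1>, and d delta w_0 = delta d w_0 is, up to sign,
    delta delta w_1 = 0.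

    To prove delta delta = 0 ([seq_delta_delta]) and the Leibniz rule
    ([seq_delta_pairing]), a [p]-cochain is evaluated on infinite sequences of
    group elements, of which it only reads the first [p] terms.  The merging of
    two neighbours, the removal of the first term and that of the last one then
    become instances of a single family of operations [seq_face i], the casts
    between equal degrees disappear, and the coboundaries for left and right
    modules become two cases of the coboundary [seq_delta] for bimodules. *)

Set Implicit Arguments.
Unset Strict Implicit.
Unset Printing Implicit Defensive.

(** * Additive maps and alternating sums *)

Lemma additive_of (A B : zmodType) (f : A -> B) :
  (forall a b, f (a + b) = f a + f b) ->
  exists g : {additive A -> B}, f = g :> (A -> B).
Proof.
move=> fD.
have fB : zmod_morphism f.
  by move=> a b; apply: (addIr (f b)); rewrite -fD !subrK.
pose g : {additive A -> B} := HB.pack f (GRing.isZmodMorphism.Build _ _ f fB).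
by exists g.
Qed.

Lemma additive_mulz (A B : zmodType) (f : A -> B) a (e : int) :
  (forall a b, f (a + b) = f a + f b) -> f (a *~ e) = f a *~ e.
Proof. by move=> /additive_of[g ->]; rewrite raddfMz. Qed.

Lemma additive_combination (A B : zmodType) (f : A -> B) (n : nat)
    (x : nat -> A) (e : nat -> int) :
  (forall a b, f (a + b) = f a + f b) ->
  f (\sum_(i < n) x i *~ e i) = \sum_(i < n) f (x i) *~ e i.
Proof.
move=> /additive_of[g ->]; rewrite raddf_sum.
by apply: eq_bigr => i _; rewrite raddfMz.
Qed.

(** The usual cancellation behind delta delta = 0.  In the induction, the terms
    added to the double sum are those of the row [j = n.+1] and of the column
    [i = n], and the hypothesis cancels them against each other. *)
Lemma cosimplicial_sum0 (A : zmodType) (n : nat) (x : nat -> nat -> A) :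
  (forall i j : nat, (i <= j < n)%N -> x j.+1 i = x i j) ->
  \sum_(j < n.+1) (\sum_(i < n) x j i *~ (-1) ^+ i) *~ (-1) ^+ j = 0.
Proof.
elim: n => [|n IH] xE.
  by rewrite big1// => j _; rewrite big_ord0 mul0rz.
rewrite big_ord_recr /=.
under eq_bigr => j _ do rewrite big_ord_recr /= mulrzDl.
rewrite big_split /= IH ?add0r; last by move=> i j ?; apply: xE; lia.
rewrite mulrz_suml -big_split /= big1// => i _.
rewrite xE; last by have := ltn_ord i; lia.
by rewrite -!mulrzA exprS mulN1r mulrN mulrNz mulrC subrr.
Qed.

(** * Group cochains on sequences *)

Section Sequences.
Context {G : groupType}.
Implicit Types (s : nat -> G) (A : zmodType).

(** Terms are indexed from 0: the terms [i.-1] and [i] are merged, and for [i = 0]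
    the term 0 is dropped.  On the first [p] terms, [seq_face p.+1] is the
    identity: it agrees there with the removal of the last of [p.+1] terms. *)
Definition seq_face (i : nat) s : nat -> G := fun j =>
  if (j.+1 < i)%N then s j
  else if j.+1 == i then (s j * s j.+1)%g else s j.+1.

Definition seq_shift (p : nat) s : nat -> G := fun j => s (p + j)%N.

Definition on_seq (A : Type) p (c : group_cochain G A p) s : A :=
  c (fun i => s i).

(** Equalities of cochains can be tested on sequences, because a tuple extends to
    a sequence by the unit of the group. *)
Lemma on_seq_inj (A : Type) p (c c' : group_cochain G A p) :
  (forall s, on_seq c s = on_seq c' s) -> c = c'.
Proof.
move=> cc'; apply/funext => g.
pose s i : G := oapp g 1%g (insub i).
suff -> : g = fun i => s i by exact: cc'.
by apply/funext => i; rewrite /s valK.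
Qed.

Lemma on_seq_local (A : Type) p (c : group_cochain G A p) s t :
  (forall i, (i < p)%N -> s i = t i) -> on_seq c s = on_seq c t.
Proof. by move=> st; congr c; apply/funext => i; exact: st. Qed.

(** The cosimplicial identity; for [i = j] it is the associativity of the group
    law. *)
Lemma seq_faceC (i j : nat) s :
  (i <= j)%N -> seq_face i (seq_face j.+1 s) = seq_face j (seq_face i s).
Proof.
move=> ij; apply/funext => k; rewrite /seq_face.
by repeat case: ifP => ?; rewrite ?mulgA//; exfalso; lia.
Qed.

(** The two extreme faces also act on the coefficients, by the term which they
    remove. *)
Definition face_act A (l : G -> A -> A) (r : A -> G -> A) (p i : nat) s
    (a : A) : A :=
  if i == 0 then l (s 0) a else if i == p.+1 then r a (s p) else a.

(** The Hochschild coboundary for a bimodule of coefficients; the coboundaries for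
    left and right modules are those where the other action is trivial. *)
Definition seq_delta A (l : G -> A -> A) (r : A -> G -> A) (p : nat)
    (C : (nat -> G) -> A) s : A :=
  \sum_(i < p.+2) face_act l r p i s (C (seq_face i s)) *~ (-1) ^+ i.

Definition trivial_ract (A : Type) (a : A) (g : G) : A := a.

Definition bimodule A (l : G -> A -> A) (r : A -> G -> A) : Prop :=
  [/\ left_module l, right_module r & forall g a h, l g (r a h) = r (l g a) h].

Lemma left_bimodule A (l : G -> A -> A) :
  left_module l -> bimodule l (@trivial_ract A).
Proof. by []. Qed.

Lemma right_bimodule A (r : A -> G -> A) :
  right_module r -> bimodule (@trivial_act G A) r.
Proof. by []. Qed.

Lemma face_actD A l r p i s (a b : A) : bimodule l r ->
  face_act l r p i s (a + b) = face_act l r p i s a + face_act l r p i s b.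
Proof. by move=> [[_ _ lD] [_ _ rD] _]; rewrite /face_act; do 2?case: ifP. Qed.

(** The coefficient part of the cosimplicial identity.  Its nontrivial
    cases are [i = j = 0], which is the associativity of the left action,
    [i = j = p.+1], that of the right action, and [i = 0] with [j = p.+1], the
    compatibility of the two actions. *)
Lemma face_actC A (l : G -> A -> A) r p i j s a : bimodule l r ->
  (i <= j <= p.+1)%N ->
  face_act l r p.+1 j.+1 s (face_act l r p i (seq_face j.+1 s) a) =
  face_act l r p.+1 i s (face_act l r p j (seq_face i s) a).
Proof.
move=> [[_ lM _] [_ rM _] lr] ijp; rewrite /face_act /seq_face.
by repeat case: ifP => ?; rewrite ?lM ?rM ?lr//; exfalso; lia.
Qed.

Lemma additive_seq_delta A (B : zmodType) (f : A -> B) l r p C s :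
  (forall a b, f (a + b) = f a + f b) ->
  f (seq_delta l r p C s) =
  \sum_(i < p.+2) f (face_act l r p i s (C (seq_face i s))) *~ (-1) ^+ i.
Proof.
move=> fD; pose x i := face_act l r p i s (C (seq_face i s)).
exact: (additive_combination p.+2 x (fun i => (-1) ^+ i) fD).
Qed.

Lemma seq_delta_delta A (l : G -> A -> A) r p C s : bimodule l r ->
  seq_delta l r p.+1 (seq_delta l r p C) s = 0.
Proof.
move=> lr; rewrite {1}/seq_delta.
under eq_bigr => j _.
  rewrite (additive_seq_delta (f := face_act l r p.+1 j s)); last first.
    by move=> a b; exact: face_actD.
  over.
pose x j i := face_act l r p.+1 j s
  (face_act l r p i (seq_face j s) (C (seq_face i (seq_face j s)))).
apply: (@cosimplicial_sum0 A p.+2 x) => i j ij.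
by rewrite /x seq_faceC ?face_actC//; lia.
Qed.

Lemma seq_deltaE A (l : G -> A -> A) r p C s :
  seq_delta l r p C s = l (s 0) (C (seq_face 0 s))
    + \sum_(i < p) C (seq_face i.+1 s) *~ (-1) ^+ i.+1
    + r (C (seq_face p.+1 s)) (s p) *~ (-1) ^+ p.+1.
Proof.
rewrite /seq_delta big_ord_recr big_ord_recl /= mulr1z /face_act /= eqxx.
congr (_ + _ + _); apply: eq_bigr => i _.
by rewrite /bump add1n eqSS ltn_eqF.
Qed.

(** Up to conversion the two sides only differ in the removal of the last term,
    which on the first [p] terms is [seq_face p.+1]. *)
Lemma seq_delta_on_seq A (l : G -> A -> A) (r : A -> G -> A) p
    (c : group_cochain G A p) s (g := fun i : 'I_p.+1 => s i) :
  seq_delta l r p (on_seq c) s =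
    l (g ord0) (c (drop_first g))
    + \sum_(i < p) c (merge_at i g) *~ (-1) ^+ i.+1
    + r (c (drop_last g)) (g ord_max) *~ (-1) ^+ p.+1.
Proof.
rewrite seq_deltaE; congr (_ + _ + r _ _ *~ _).
congr c; apply/funext => j; rewrite /drop_last /g /seq_face ltnS ltn_ord.
by congr s; rewrite /= /bump leqNgt ltn_ord.
Qed.

Lemma on_seq_delta_left A (l : G -> A -> A) p (c : group_cochain G A p) s :
  on_seq (delta_left l c) s = seq_delta l (@trivial_ract A) p (on_seq c) s.
Proof. by rewrite seq_delta_on_seq. Qed.

Lemma on_seq_delta_right A (r : A -> G -> A) p (c : group_cochain G A p) s :
  on_seq (delta_right r c) s =
  seq_delta (@trivial_act G A) r p (on_seq c) s.
Proof. by rewrite seq_delta_on_seq. Qed.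

Lemma delta_right_delta_right A (r : A -> G -> A) p (c : group_cochain G A p) :
  right_module r -> delta_right r (delta_right r c) = fun=> 0.
Proof.
move=> rM; apply: on_seq_inj => s; rewrite on_seq_delta_right.
rewrite (_ : on_seq _ = seq_delta (@trivial_act G A) r p (on_seq c)).
  by rewrite seq_delta_delta//; exact: right_bimodule.
by apply/funext => t; exact: on_seq_delta_right.
Qed.

Lemma delta_left_delta_left A (l : G -> A -> A) p (c : group_cochain G A p) :
  left_module l -> delta_left l (delta_left l c) = fun=> 0.
Proof.
move=> lM; apply: on_seq_inj => s; rewrite on_seq_delta_left.
rewrite (_ : on_seq _ = seq_delta l (@trivial_ract A) p (on_seq c)).
  by rewrite seq_delta_delta//; exact: left_bimodule.
by apply/funext => t; exact: on_seq_delta_left.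
Qed.

(** Naturality in the coefficients. *)
Lemma seq_delta_map A (B : zmodType) (l : G -> A -> A) r (l' : G -> B -> B) r'
    (f : A -> B) p C s :
  (forall a b, f (a + b) = f a + f b) ->
  (forall g a, f (l g a) = l' g (f a)) ->
  (forall a g, f (r a g) = r' (f a) g) ->
  f (seq_delta l r p C s) = seq_delta l' r' p (f \o C) s.
Proof.
move=> fD fl fr.
rewrite additive_seq_delta//; apply: eq_bigr => i _; congr (_ *~ _).
by rewrite /face_act; do 2?case: ifP.
Qed.

Lemma delta_leftB A (l : G -> A -> A) p (c c' : group_cochain G A p) :
  left_module l ->
  delta_left l (fun g => c g - c' g) =
  fun g => delta_left l c g - delta_left l c' g.
Proof.
move=> lM; apply: on_seq_inj => s.
transitivity (on_seq (delta_left l c) s - on_seq (delta_left l c') s) => //.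
rewrite !on_seq_delta_left /seq_delta -sumrB; apply: eq_bigr => i _.
have [f fE] := additive_of (fun a b => face_actD p i s a b (left_bimodule lM)).
by rewrite fE [on_seq _ _]/(on_seq c _ - on_seq c' _) raddfB mulrzBl.
Qed.

Lemma cohomologous_refl p (c : group_cochain G int p.+1) : cohomologous c c.
Proof.
exists (fun=> 0 - 0); rewrite delta_leftB; last exact: trivial_left_module.
by apply/funext => g; rewrite !subrr.
Qed.

(** Together with reflexivity, this form gives symmetry and transitivity at
    once. *)
Lemma cohomologous_euclidean p (c c' c'' : group_cochain G int p.+1) :
  cohomologous c c' -> cohomologous c c'' -> cohomologous c' c''.
Proof.
move=> [b bE] [b' b'E]; exists (fun g => b' g - b g).
rewrite delta_leftB; last exact: trivial_left_module.
by rewrite bE b'E; apply/funext => g; rewrite opprB addrC addrA subrK.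
Qed.

Lemma cohomologous_cocycle p (c c' : group_cochain G int p.+1) :
  cohomologous c c' -> cocycle c -> cocycle c'.
Proof.
move=> [b bE] cz.
have c'E : c' = fun g => c g - delta_left (@trivial_act G int) b g.
  by rewrite bE; apply/funext => g; rewrite opprB addrC subrK.
have triv := @trivial_left_module G int.
by rewrite /cocycle c'E delta_leftB// cz delta_left_delta_left//.
Qed.

(** The Leibniz rule.  The first [p.+1] faces only affect the arguments of [a] and
    the last [q.+1] faces only those of [b].  The right-hand side has two more
    terms: the right action on [a] by [s p], in the last term of [delta_right],
    and the left action on [b] by [s p], in the first term of [delta_left].
    They have opposite signs, and cancel because the pairing is balanced. *)
Lemma seq_delta_pairing A (B Z : zmodType) (l : G -> B -> B) (r : A -> G -> A)
    (ev : A -> B -> Z) p q (a : group_cochain G A p) (b : group_cochain G B q) s :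
  (forall u v z, ev (u + v) z = ev u z + ev v z) ->
  (forall u z t, ev u (z + t) = ev u z + ev u t) ->
  (forall u g z, ev (r u g) z = ev u (l g z)) ->
  seq_delta (@trivial_act G Z) (@trivial_ract Z) (p + q)
    (fun t => ev (on_seq a t) (on_seq b (seq_shift p t))) s =
  ev (on_seq (delta_right r a) s) (on_seq b (seq_shift p.+1 s)) +
  ev (on_seq a s) (on_seq (delta_left l b) (seq_shift p s)) *~ (-1) ^+ p.
Proof.
move=> evDl evDr evM.
rewrite on_seq_delta_right on_seq_delta_left.
set b' := on_seq b (seq_shift p.+1 s).
have faceL i : (i <= p)%N ->
    seq_shift p (seq_face i s) = seq_shift p.+1 s.
  move=> ip; apply/funext => j; rewrite /seq_shift /seq_face addSn.
  by do 2?[case: ifP => ?; first by exfalso; lia].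
have faceR i :
    seq_shift p (seq_face (p + i).+1 s) = seq_face i.+1 (seq_shift p s).
  apply/funext => j; rewrite /seq_shift /seq_face.
  by rewrite !ltnS !eqSS ltn_add2l eqn_add2l addnS.
have localR i : (p <= i)%N -> on_seq a (seq_face i.+1 s) = on_seq a s.
  by move=> pi; apply: on_seq_local => j jp; rewrite /seq_face ifT//; lia.
have face0 : seq_face 0 (seq_shift p s) = seq_shift p.+1 s.
  by apply/funext => j; rewrite /seq_shift /seq_face addSn addnS.
have evDb : forall u v, ev (u + v) b' = ev u b' + ev v b' by move=> u v.
have evDa := evDr (on_seq a s).
rewrite !seq_deltaE !evDb !evDa face0 big_split_ord /=.
rewrite (additive_combination p (fun i => on_seq a (seq_face i.+1 s))
  (fun i => (-1) ^+ i.+1) evDb).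
rewrite (additive_combination q
  (fun i => on_seq b (seq_face i.+1 (seq_shift p s)))
  (fun i => (-1) ^+ i.+1) evDa).
rewrite (additive_mulz _ _ evDb) (additive_mulz _ _ evDa) evM.
rewrite /trivial_act /trivial_ract [seq_shift p s 0%N]/seq_shift addn0.
rewrite faceL// faceR !localR ?leq_addr//.
under eq_bigr => i _ do rewrite faceL//.
under [X in _ + (_ + X) + _ = _]eq_bigr => i _ do
  rewrite faceR localR ?leq_addr// -addnS addnC exprD mulrzA.
rewrite -mulrz_suml -/b' -addnS addnC !exprD !mulrzA !mulrzDl.
rewrite [(-1) ^+ p.+1]exprS mulN1r mulrNz.
by rewrite !addrA subrK.
Qed.

End Sequences.

(** * The evaluation pairing *)

Section Evaluation.
Context {R : realType} {m : nat} {M : manifold R m}.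

Lemma sing_evalDr p (u : sing_cochain M int p) y z :
  sing_eval u (y + z) = sing_eval u y + sing_eval u z.
Proof. exact: (fgliftD (u : sing M p -> int^o)). Qed.

Lemma sing_eval_simplex p (u : sing_cochain M int p) s :
  sing_eval u (simplex_chain s) = u s.
Proof. by rewrite /sing_eval liftU scale1r. Qed.

Lemma sing_evalDl p (u v : sing_cochain M int p) z :
  sing_eval (u + v) z = sing_eval u z + sing_eval v z.
Proof.
apply: (chain_ext (f := sing_eval (u + v))
  (g := fun z => sing_eval u z + sing_eval v z)) z.
- exact: sing_evalDr.
- by move=> y z; rewrite !sing_evalDr addrACA.
- by move=> s; rewrite !sing_eval_simplex.
Qed.

Lemma sing_eval0 p (z : sing_chain M p) :
  sing_eval (0 : sing_cochain M int p) z = 0.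
Proof. by apply: (addrI (sing_eval 0 z)); rewrite -sing_evalDl !addr0. Qed.

Lemma sing_evalMzl p (u : sing_cochain M int p) (e : int) z :
  sing_eval (u *~ e) z = sing_eval u z *~ e.
Proof.
apply: (additive_mulz (f := fun v : sing_cochain M int p => sing_eval v z)).
by move=> a b; exact: sing_evalDl.
Qed.

Lemma sing_eval_push p (u : sing_cochain M int p) f z :
  sing_eval (pull_cochain u f) z = sing_eval u (push_chain f z).
Proof.
apply: (chain_ext (g := fun z => sing_eval u (push_chain f z))) z.
- exact: sing_evalDr.
- by move=> y z; rewrite [push_chain f _]fgliftD sing_evalDr.
- by move=> s; rewrite push_chain_simplex !sing_eval_simplex.
Qed.

Lemma sing_boundaryD p (y z : sing_chain M p.+1) :
  sing_boundary (y + z) = sing_boundary y + sing_boundary z.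
Proof. exact: fgliftD. Qed.

Lemma sing_eval_boundary p (u : sing_cochain M int p) (z : sing_chain M p.+1) :
  sing_eval u (sing_boundary z) = sing_eval (sing_d u) z.
Proof.
apply: (chain_ext (f := fun z => sing_eval u (sing_boundary z))) z.
- by move=> y z; rewrite sing_boundaryD sing_evalDr.
- exact: sing_evalDr.
move=> s; rewrite sing_eval_simplex /sing_boundary liftU scale1r.
have [g gE] := additive_of (sing_evalDr u).
rewrite gE raddf_sum; apply: eq_bigr => i _.
rewrite -[X in X *: _]intz scaler_int raddfMz -gE sing_eval_simplex.
by rewrite -mulrzl intz.
Qed.

Lemma sing_dD p (u v : sing_cochain M int p) :
  sing_d (u + v) = sing_d u + sing_d v.
Proof.
apply/funext => s; rewrite /sing_d [RHS]/GRing.add /= -big_split /=.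
by apply: eq_bigr => i _; rewrite -mulrDr.
Qed.

Lemma sing_d_pull p (u : sing_cochain M int p) f :
  sing_d (pull_cochain u f) = pull_cochain (sing_d u) f.
Proof.
apply/funext => s; apply: eq_bigr => i _; congr (_ * u _).
exact/continuousEP.
Qed.

End Evaluation.

(** * Comparison of the cochains c_k *)

Section Comparison.
Context {R : realType} {m : nat} {M : manifold R m} {n : nat}.
Context {Omega : dform M n}.
Unset Implicit Arguments.
Context (w : forall k,
  group_cochain (diff_form Omega) (sing_cochain M int k) (n - k)).
Context (Delta : forall k, group_cochain (diff_form Omega) (sing_chain M k) k).
Set Implicit Arguments.

Lemma on_seq_c_cochain k (kn : (k <= n)%N) s :
  on_seq (c_cochain w Delta kn) s =
  sing_eval (on_seq (delta_right (@pull _ _ _ _ Omega int k) (w k)) s)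
    (on_seq (Delta k) (seq_shift (n - k).+1 s)).
Proof. by []. Qed.

Lemma seq_delta_eval k p q (a : group_cochain _ (sing_cochain M int k) p)
    (b : group_cochain _ (sing_chain M k) q) s :
  seq_delta (@trivial_act _ int) (@trivial_ract _ int) (p + q)
    (on_seq (pairing a b)) s =
  sing_eval (on_seq (delta_right (@pull _ _ _ _ Omega int k) a) s)
    (on_seq b (seq_shift p.+1 s)) +
  sing_eval (on_seq a s)
    (on_seq (delta_left (@push _ _ _ _ Omega k) b) (seq_shift p s)) *~ (-1) ^+ p.
Proof.
apply: (seq_delta_pairing (ev := @sing_eval _ _ M k)).
- by move=> u v z; exact: sing_evalDl.
- by move=> u z t; exact: sing_evalDr.
- by move=> u g z; exact: sing_eval_push.
Qed.

Lemma seq_delta_degree p q (A : zmodType) l r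
    (C : (nat -> diff_form Omega) -> A) s :
  p = q -> seq_delta l r p C s = seq_delta l r q C s.
Proof. by move=> ->. Qed.

Context (delta_Delta : forall k : nat, (k < n)%N ->
  delta_left (push (Omega := Omega) (p := k)) (Delta k) =
  fun g => sing_boundary (Delta k.+1 g)).
Context (delta_w : forall (k : nat) (kn : (k < n)%N),
  delta_right (pull (Omega := Omega) (A := int) (p := k.+1)) (w k.+1) =
  cast_cochain (w_degree kn)
    (fun g => sing_d (w k g) *~ - (-1) ^+ (n - k.+1).+1)).

Lemma on_seq_delta_w k s : (k < n)%N ->
  on_seq (delta_right (@pull _ _ _ _ Omega int k.+1) (w k.+1)) s =
  sing_d (on_seq (w k) s) *~ - (-1) ^+ (n - k).
Proof.
move=> kn; rewrite (delta_w kn).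
by have -> : (-1) ^+ (n - k) = (-1) ^+ (n - k.+1).+1 :> int by rewrite subnSK.
Qed.

(** The difference is the coboundary of the pairing of [w k] with [Delta k]: the
    first term of the Leibniz rule is c_k, the second one is - c_(k+1). *)
Lemma c_cochain_succ k (kn : (k <= n)%N) (kn' : (k < n)%N) :
  cohomologous (c_cochain w Delta kn) (c_cochain w Delta kn').
Proof.
exists (cast_cochain (subnK kn) (pairing (w k) (Delta k))).
apply: on_seq_inj => s; rewrite on_seq_delta_left.
rewrite [RHS]/(on_seq (c_cochain w Delta kn) s - on_seq (c_cochain w Delta kn') s).
rewrite (seq_delta_degree _ _ _ _ (esym (subnK kn))).
rewrite seq_delta_eval !on_seq_c_cochain on_seq_delta_w// delta_Delta//.
congr (_ + _).
by rewrite sing_evalMzl mulrNz opprK subnSK// -sing_eval_boundary.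
Qed.

(** Both terms of the Leibniz rule vanish, as delta delta w_0 = 0 and
    d delta w_0 = delta d w_0 is a multiple of delta delta w_1. *)
Lemma c_cochain0_cocycle : (0 < n)%N -> cocycle (c_cochain w Delta (leq0n n)).
Proof.
pose pull0 := @pull _ _ _ _ Omega int 0.
pose pull1 := @pull _ _ _ _ Omega int 1.
move=> n_gt0; apply: on_seq_inj => s; rewrite on_seq_delta_left.
rewrite (seq_delta_degree _ _ _ _ (esym (c_degree (leq0n n)))).
rewrite seq_delta_eval delta_Delta// [on_seq (fun g => sing_boundary _) _]/on_seq.
rewrite sing_eval_boundary.
have -> : sing_d (on_seq (delta_right pull0 (w 0%N)) s) = 0.
  rewrite on_seq_delta_right.
  rewrite (seq_delta_map (f := @sing_d _ _ M int 0)
    (l' := @trivial_act _ _) (r' := @pull _ _ _ _ Omega int 1)) //; first last.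
  - by move=> u f; exact: sing_d_pull.
  - exact: sing_dD.
  (* [d w_0] is a multiple of [delta w_1] because the sign [e] is its own
     inverse. *)
  pose e : int := - (-1) ^+ (n - 0).
  have wE : @sing_d _ _ M int 0 \o on_seq (w 0%N) =
      (fun u => u *~ e) \o on_seq (delta_right pull1 (w 1%N)).
    apply/funext => t /=; rewrite on_seq_delta_w// -/e -mulrzA.
    by rewrite mulrNN -expr2 sqrr_sign.
  rewrite wE -(seq_delta_map (f := fun u => u *~ e) (l := @trivial_act _ _)
    (r := pull1)) //; last 2 first.
  - by move=> u v; exact: mulrzDl.
  - move=> u f; have [_ _ pullD] := @pull_right_module _ _ _ _ Omega int 1.
    by rewrite (additive_mulz (f := fun u => pull u f)).
  rewrite (@seq_delta_degree _ (n - 1).+1); last by lia.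
  rewrite -on_seq_delta_right delta_right_delta_right ?mul0rz//.
  exact: pull_right_module.
rewrite delta_right_delta_right; last exact: pull_right_module.
by rewrite !sing_eval0 mul0rz addr0.
Qed.

Lemma c_cochain_cohomologous0 k (kn : (k <= n)%N) :
  cohomologous (c_cochain w Delta (leq0n n)) (c_cochain w Delta kn).
Proof.
elim: k kn => [|k IH] kn.
  by rewrite (bool_irrelevance kn (leq0n n)); exact: cohomologous_refl.
apply: cohomologous_euclidean (c_cochain_succ (ltnW kn) kn).
exact: cohomologous_euclidean (IH _) (cohomologous_refl _).
Qed.

End Comparison.

Theorem proposition2p3 (R : realType) (m : nat) (M : manifold R m) (n : nat)
    (Omega : dform M n)
    (M_connected : connected [set: M])
    (n_gt0 : (0 < n)%N)
    (Hn_neq0 : ~ homology_trivial M n)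
    (n_min : forall j : nat, (0 < j < n)%N -> homology_trivial M j)
    (Omega_closed : closed_form Omega)
    (Omega_neq0 : ~ deRham_class Omega (fun=> 0))
    (Omega_integral : exists u : sing_cochain M int n, integral_class Omega u)
    (x : M)
    (Delta : forall k : nat,
      group_cochain (diff_form Omega) (sing_chain M k) k)
    (Delta0 : Delta 0%N = fun=> point_chain x)
    (delta_Delta : forall k : nat, (k < n)%N ->
      delta_left (push (Omega := Omega) (p := k)) (Delta k) =
      fun g => sing_boundary (Delta k.+1 g))
    (w : forall k : nat,
      group_cochain (diff_form Omega) (sing_cochain M int k) (n - k))
    (wn : sing_cochain M int n)
    (wn_class : integral_class Omega wn)
    (w_n : w n = fun=> wn)
    (delta_w : forall (k : nat) (kn : (k < n)%N),
      delta_right (pull (Omega := Omega) (A := int) (p := k.+1)) (w k.+1) =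
      cast_cochain (w_degree kn)
        (fun g => sing_d (w k g) *~ - (-1) ^+ (n - k.+1).+1)) :
  (forall (k : nat) (kn : (k <= n)%N), cocycle (c_cochain w Delta kn)) /\
  (forall (k l : nat) (kn : (k <= n)%N) (ln : (l <= n)%N),
    cohomologous (c_cochain w Delta kn) (c_cochain w Delta ln)).
Proof.
have c0k k (kn : (k <= n)%N) :
    cohomologous (c_cochain w Delta (leq0n n)) (c_cochain w Delta kn).
  exact: c_cochain_cohomologous0.
split=> [k kn | k l kn ln].
  apply: cohomologous_cocycle (c0k _ kn) _.
  exact: c_cochain0_cocycle.
exact: cohomologous_euclidean (c0k _ kn) (c0k _ ln).
Qed.
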